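(* Let $n$ tend to infinity through a sequence $(n_k)_{k\ge1}$ of positive integers (so $n_k\to\infty$), and for each $n$ in the sequence let $$A_n=\{b_n+i c_n:\ i\in\mathbb{Z},\ 0\le i<L_n\}\subset\mathbb{Z}_{>0}$$ be an arithmetic progression with $b_n,c_n\in\mathbb{Z}$ and $L_n\in\mathbb{Z}_{>0}$, and suppose that $A_n$ has the $n$-divisor property. Put $H_n=\max A_n$. If $\log H_n=o(\sqrt n)$ as $n\to\infty$ along the sequence, then $$L_n\ \ge\ \left(\sqrt{\frac{8}{27}}-o(1)\right)\frac{n^{3/4}}{\sqrt{\log n}}.$$ Equivalently, for every $\varepsilon>0$, for all sufficiently large $n$ in the sequence, $$L_n\ \ge\ \left(\sqrt{\frac{8}{27}}-\varepsilon\right)\frac{n^{3/4}}{\sqrt{\log n}}.$$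
   Context: For $n\in\mathbb{Z}_{>0}$, a finite set $A\subset\mathbb{Z}_{>0}$ has the $n$-divisor property if every $d\in\{1,\ldots,n\}$ divides at least one member of $A$. All terms of the progressions are positive integers; the common difference $c_n$ may be any integer (positive, negative or zero). The number $L_n$ is the length (number of indices) of the progression. The notation $o(\cdot)$ refers to $n\to\infty$ along the given sequence. $\log$ is the natural logarithm. *)

(* Defs.v *)
From HB Require Import structures.
From mathcomp Require Import all_boot all_order all_algebra.
From mathcomp Require Import all_classical all_reals all_analysis.

Set Implicit Arguments.
Unset Strict Implicit.
Unset Printing Implicit Defensive.

Import Order.TTheory GRing.Theory Num.Theory.
Import numFieldNormedType.Exports.

Local Open Scope classical_set_scope.
Local Open Scope ring_scope.

(* [L] counts indices, so for [c = 0] it is not the cardinality. *)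
Definition arith_prog (b c : int) (L : nat) : set int :=
  [set b + i%:Z * c | i in `I_L].

Definition divisor_property (n : nat) (A : set int) : Prop :=
  forall d : nat, (1 <= d <= n)%N -> exists2 a : int, A a & (d%:Z %| a)%Z.

Definition is_max (A : set int) (m : int) : Prop := A m /\ ubound A m.

(* Main.v *)
(* With X = floor (sqrt n), let P be the set of primes in (X / 100, X] that do
   not divide c, and for every index i let S_i be the set of those p in P that
   divide b + i c.  Two primes of P have a product at most n, so both lie in
   some S_i; and p in S_i, p in S_j forces i = j mod p, so that distinct S_i
   and S_j share at most one prime (if L <= (X / 100)^2; otherwise the bound is
   immediate).  The S_i are thus the lines of a linear space on P.  As in the
   theorem of de Bruijn and Erdos, a point p outside a longest line lies on d
   lines with #|P| - 1 <= d^2.  The d corresponding indices are congruent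
   modulo p, hence (d - 1) p < L.
   Since ln H = o(X), Chebyshev-type bounds on the product of the primes up to X
   give #|P| ln X >= (98 / 100 * ln 2 - o(1)) X, and show that the primes in
   (49 X / 100, X] have a product exceeding H^2.  One of them therefore divides
   neither c nor the member of the progression attached to the longest line,
   and p can be taken above 49 X / 100.  The resulting constant is larger than
   sqrt (8 / 27), so the error term can be taken to be 0. *)
Require Import Defs.
From HB Require Import structures.
From mathcomp Require Import all_boot all_order all_algebra.
From mathcomp Require Import all_classical all_reals all_analysis.
From mathcomp Require Import zify ring lra.

Set Implicit Arguments.
Unset Strict Implicit.
Unset Printing Implicit Defensive.

Import Order.TTheory GRing.Theory Num.Theory.
Import numFieldNormedType.Exports.

(** * Products of primes and Chebyshev's bounds in integer form *)

Lemma ex_sqrtn (n : nat) : exists r, r * r <= n < r.+1 * r.+1.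
Proof.
elim: n => [|n [r]]; first by exists 0.
case: (ltnP n.+1 (r.+1 * r.+1)) => ? ?; [exists r | exists r.+1]; nia.
Qed.

Lemma prod_primes_dvd (r : seq nat) (P : pred nat) (a : nat) :
  uniq r -> {in r, forall p, P p -> prime p && (p %| a)} ->
  \prod_(p <- r | P p) p %| a.
Proof.
elim: r => [|p r IHr] /=; first by rewrite big_nil dvd1n.
case/andP=> pNr Ur PPr; rewrite big_cons.
have {}IHr : \prod_(q <- r | P q) q %| a.
  by apply: IHr => // q qr; apply: PPr; rewrite inE qr orbT.
case: ifP => // Pp; have /andP[p_pr p_a] := PPr p (mem_head _ _) Pp.
rewrite Gauss_dvd ?p_a ?IHr // prime_coprime // Euclid_dvd_prod // big_has_cond.
apply/hasP=> -[q qr /andP[Pq]].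
have /andP[q_pr _] := PPr q (@mem_behead _ (p :: r) q qr) Pq.
by rewrite dvdn_prime2 // => /eqP def_q; rewrite def_q qr in pNr.
Qed.

Lemma prime_dvd_fact p n : prime p -> (p %| n`!) = (p <= n).
Proof.
move=> p_pr; apply/idP/idP => [|le_pn]; last by rewrite dvdn_fact // prime_gt0.
elim: n => [|n IHn]; first by rewrite Euclid_dvd1.
rewrite factS Euclid_dvdM // => /orP[/dvdn_leq->//|/IHn/leqW//].
Qed.

(** The expansion of (1 + 1)^(2m + 1) contains this binomial coefficient twice, at the positions m
    and m + 1. *)
Lemma central_bin_ub m : 'C(m.*2.+1, m) <= 4 ^ m.
Proof.
suff : 2 * 'C(m.*2.+1, m) <= 2 ^ m.*2.+1.
  by rewrite expnS -mul2n expnM leq_pmul2l.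
rewrite (expnDn 1 1) /=.
under eq_bigr do rewrite !exp1n !muln1.
have lt1 : m < m.*2.+2 by lia.
have lt2 : m.+1 < m.*2.+2 by lia.
rewrite (bigD1 (Ordinal lt1)) //= (bigD1 (Ordinal lt2)) /=; last first.
  by rewrite -val_eqE /= neq_ltn ltnSn orbT.
have -> : 'C(m.*2.+1, m.+1) = 'C(m.*2.+1, m).
  by rewrite -bin_sub; [congr 'C(_, _); lia | lia].
by rewrite addnA addnn mul2n leq_addr.
Qed.

Lemma central_bin_lb m : 4 ^ m <= m.*2.+1 * 'C(m.*2, m).
Proof.
elim: m => [|m IHm] //; rewrite doubleS expnS.
have E1 := mul_bin_diag m.*2.+2 m.
have E2 := mul_bin_down m.*2.+1 m.
rewrite /= in E1 E2.
have E3 : m.*2.+1 - m = m.+1 by lia.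
rewrite {}E3 in E2.
have E4 : 'C(m.*2.+2, m.+1) = 2 * 'C(m.*2.+1, m).
  apply/eqP; rewrite -(eqn_pmul2l (ltn0Sn m)) -E1; apply/eqP; lia.
rewrite E4; apply: leq_trans (_ : 4 * (m.+1 * 'C(m.*2.+1, m)) <= _); first by rewrite -E2 leq_pmul2l.
nia.
Qed.

(** By Legendre's formula the exponent is the sum over k of floor(2m / p^k) - 2 floor(m / p^k). Each
    term is at most 1, and it vanishes once p^k > 2m. *)
Lemma logn_central_bin p m : prime p -> 0 < m ->
  p ^ logn p 'C(m.*2, m) <= m.*2.
Proof.
move=> p_pr m_gt0; have p_gt1 := prime_gt1 p_pr.
apply: leq_trans (trunc_logP p_gt1 _); last by rewrite double_gt0.
rewrite leq_exp2l //.
have le_m : m <= m.*2 by lia.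
have := congr1 (logn p) (bin_fact le_m).
rewrite (_ : m.*2 - m = m); last by lia.
rewrite !lognM ?muln_gt0 ?fact_gt0 ?bin_gt0 // !logn_fact //.
set t := trunc_log p _.
(* Legendre's sum for m is extended to the range of the sum for 2m; the new terms vanish because p^k
   > k > m. *)
have -> : \sum_(1 <= k < m.+1) m %/ p ^ k = \sum_(1 <= k < m.*2.+1) m %/ p ^ k.
  rewrite [RHS](big_cat_nat _ (n := m.+1)) //=.
  rewrite [X in _ = _ + X]big_nat_cond [X in _ = _ + X]big1 ?addn0 // => k.
  rewrite andbT => /andP[mk _]; rewrite divn_small //.
  exact: ltn_trans mk (ltn_expl _ _).
have : \sum_(1 <= k < m.*2.+1) m.*2 %/ p ^ k <=
    \sum_(1 <= k < m.*2.+1) ((k <= t) + (m %/ p ^ k + m %/ p ^ k)).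
  rewrite big_nat_cond [leqRHS]big_nat_cond; apply: leq_sum => k /andP[/andP[k1 _] _].
  have pk_gt0 : 0 < p ^ k by rewrite expn_gt0 prime_gt0.
  case: (leqP k t) => [_|tk].
    have lt_m := ltn_ceil m pk_gt0; rewrite add1n -ltnS ltn_divLR //; nia.
  rewrite divn_small //; apply: leq_trans (trunc_log_ltn _ p_gt1) _.
  by rewrite leq_exp2l.
rewrite !big_split /=.
have : \sum_(1 <= k < m.*2.+1) (k <= t) <= t.
  have -> : \sum_(1 <= k < m.*2.+1) (k <= t) = \sum_(1 <= k < m.*2.+1 | k <= t) 1.
    by rewrite [RHS]big_mkcond; apply: eq_bigr => k _; case: (k <= t).
  rewrite sum1_count -size_filter -[leqRHS](size_iota 1 t).
  apply: uniq_leq_size => [|k]; first by rewrite filter_uniq // iota_uniq.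
  rewrite mem_filter mem_index_iota mem_iota => /andP[le_kt /andP[k_gt0 _]].
  by rewrite k_gt0 add1n ltnS.
lia.
Qed.

(** The logarithm of this product is Chebyshev's function theta(n). *)
Definition primorial n := \prod_(0 <= p < n.+1 | prime p) p.

Lemma prod_primes_gt0 (r : seq nat) : 0 < \prod_(p <- r | prime p) p.
Proof. by apply: prodn_cond_gt0 => p /prime_gt0. Qed.

Lemma primorial_gt0 n : 0 < primorial n.
Proof. exact: prod_primes_gt0. Qed.

Lemma primorial_cat m n : m <= n ->
  primorial n = primorial m * \prod_(m.+1 <= p < n.+1 | prime p) p.
Proof. by move=> le_mn; rewrite /primorial (big_cat_nat _ (n := m.+1)). Qed.

(** Strong induction. If n = 2m + 1, every prime in (m + 1, 2m + 1] divides 'C(2m + 1, m), which is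
    at most 4^m; an even n > 2 is not prime and contributes nothing. *)
Lemma primorial_ub n : primorial n <= 4 ^ n.
Proof.
elim/ltn_ind: n => n IHn.
have [|n_gt2] := leqP n 2.
  by case: n {IHn} => [|[|[|]]] // _; rewrite /primorial unlock.
have [n_odd|n_even] := boolP (odd n).
  have [m def_n] : exists m, n = m.*2.+1 by exists n./2; lia.
  rewrite (@primorial_cat m.+1) ?def_n; last by lia.
  rewrite (_ : 4 ^ _ = 4 ^ m.+1 * 4 ^ m); last by rewrite -expnD; congr (_ ^ _); lia.
  apply: leq_mul; first by apply: IHn; lia.
  apply: leq_trans (central_bin_ub m).
  apply: dvdn_leq; first by rewrite bin_gt0; lia.
  apply: prod_primes_dvd => [|p]; first exact: iota_uniq.
  rewrite mem_index_iota => /andP[mp pm] p_pr; rewrite p_pr.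
  have le_m : m <= m.*2.+1 by lia.
  have : p %| (m.*2.+1)`! by rewrite prime_dvd_fact.
  rewrite -(bin_fact le_m) !Euclid_dvdM // !prime_dvd_fact //.
  by case/or3P=> //; lia.
have n_gt0 : 0 < n by lia.
have n_npr : ~~ prime n by apply: contra n_even => /even_prime[]; lia.
rewrite /primorial big_mkcond big_nat_recr //= (negPf n_npr) muln1 -big_mkcond.
rewrite -(prednK n_gt0); apply: leq_trans (IHn _ _) _; first by rewrite ltn_predL.
by rewrite leq_exp2l // prednK // leq_pred.
Qed.

(* Every prime power dividing 'C(2m, m) is at most 2m, and the primes above r
   divide it at most once. *)
Lemma primorial_lb m r : 0 < m -> m.*2 < r.+1 ^ 2 ->
  4 ^ m <= m.*2.+1 * (m.*2 ^ r * primorial m.*2).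
Proof.
move=> m_gt0 lt_m_r; apply: leq_trans (central_bin_lb m) _; rewrite leq_mul2l /=.
set C := 'C(_, _).
have C_gt0 : 0 < C by rewrite bin_gt0; lia.
have C_p p : prime p -> p ^ logn p C <= m.*2 by move=> p_pr; apply: logn_central_bin.
have -> : C = \prod_(0 <= p < m.*2.+1 | prime p) p ^ logn p C.
  rewrite -[LHS]partnT // (@widen_partn (maxn C m.*2)) ?leq_maxl //.
  rewrite (big_cat_nat _ (n := m.*2.+1)) //=; last by rewrite ltnS leq_maxr.
  rewrite [X in _ * X]big_nat_cond [X in _ * X]big1 ?muln1 => [|p /andP[/andP[lt_m_p _] _]].
    rewrite [RHS]big_mkcond; apply: eq_bigr => p _.
    by case: ifP => // p_npr; rewrite lognE p_npr.
  have [p_pr|p_npr] := boolP (prime p); last by rewrite lognE (negPf p_npr).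
  have := leq_ltn_trans (C_p p p_pr) lt_m_p.
  by rewrite -[X in _ < X]expn1 ltn_exp2l ?prime_gt1 // ltnS leqn0 => /eqP->.
apply: leq_trans (_ : \prod_(0 <= p < m.*2.+1 | prime p) ((if p <= r then m.*2 else 1) * p) <= _).
  apply: leq_prod => p p_pr; case: (leqP p r) => [_|lt_r_p].
    by apply: leq_trans (C_p p p_pr) _; rewrite leq_pmulr // prime_gt0.
  rewrite mul1n -[leqRHS]expn1 leq_exp2l ?prime_gt1 // -ltnS.
  rewrite -(ltn_exp2l _ _ (prime_gt1 p_pr)); apply: leq_ltn_trans (C_p p p_pr) _.
  by apply: leq_trans lt_m_r _; rewrite leq_exp2r.
rewrite big_split leq_mul2r; apply/orP; right => /=.
rewrite -big_mkcondr /= big_const_seq iter_muln_1 leq_exp2l; last by lia.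
rewrite -size_filter -[leqRHS](size_iota 1 r) uniq_leq_size ?filter_uniq ?iota_uniq // => p.
by rewrite mem_filter mem_iota => /andP[/andP[/prime_gt0]]; lia.
Qed.

(** * Linear spaces and the prime divisors of a progression *)

(** Let d be the number of lines through p. Joining p to each point of a longest line shows that no
    line has more than d points, and the d lines through p cover all other points of P. *)
Lemma linear_space_card_le (T I : finType) (P : {set T}) (S : I -> {set T})
    (cover : {in P &, forall p q, p != q -> exists2 i, p \in S i & q \in S i})
    (sep : forall i j p q, p != q -> p \in S i -> q \in S i ->
       p \in S j -> q \in S j -> i = j)
    (S_P : forall i, S i \subset P) (i0 : I) (p : T) :
  (forall i, #|S i| <= #|S i0|) -> p \in P -> p \notin S i0 ->
  #|P| <= #|[set i | p \in S i]| ^ 2 + 1.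
Proof.
move=> S_max pP pNS; set D := [set i | _].
(* [f q] is a line joining p and q. The default [i0] is returned only if there is none, which
   [cover] excludes for q in P other than p. *)
pose f q := odflt i0 [pick i | (p \in S i) && (q \in S i)].
have fP q : q \in P -> q != p -> (p \in S (f q)) /\ (q \in S (f q)).
  move=> qP qp; rewrite /f; case: pickP => [i /andP[]|] //= none.
  have [|i pi qi] := cover p q pP qP; first by rewrite eq_sym.
  by move: (none i); rewrite pi qi.
have S0 q : q \in S i0 -> q \in P /\ q != p.
  move=> q0; split; first exact: (fintype.subsetP (S_P i0)).
  by apply: contraNneq pNS => <-.
(* The lines joining p to the points of S i0 are pairwise distinct. *)
have le_D : #|S i0| <= #|D|.
  rewrite -(card_in_imset (f := f) (D := mem (S i0))) => [|q r q0 r0 eq_f].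
    apply/subset_leq_card/fintype.subsetP => _ /imsetP[q /S0[qP qp] ->].
    by rewrite inE; case: (fP q qP qp).
  have [[qP qp] [rP rp]] := (S0 q q0, S0 r r0).
  apply/eqP; apply: contraT => qr.
  have [[pq qq] [pr rr]] := (fP q qP qp, fP r rP rp).
  rewrite -eq_f in pr rr.
  by case/negP: pNS; rewrite (sep i0 _ q r qr q0 r0 qq rr).
rewrite (cardsD1 p) pP addnC leq_add2r.
have : P :\ p \subset \bigcup_(i in D) S i.
  apply/fintype.subsetP => q; rewrite !inE => /andP[qp qP].
  have [pq qq] := fP q qP qp.
  by apply/finset.bigcupP; exists (f q); rewrite ?inE.
move/subset_leq_card/leq_trans; apply.
apply: leq_trans (_ : \sum_(i in D) #|S i| <= _).
  elim/big_rec2: _ => [|i s A _ le_A]; first by rewrite cards0.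
  by apply: leq_trans (leq_card_setU _ _) _; rewrite leq_add2l.
apply: leq_trans (_ : \sum_(i in D) #|D| <= _).
  by apply: leq_sum => i _; apply: leq_trans (S_max i) le_D.
by rewrite sum_nat_const.
Qed.

(** Congruent indices are told apart by their quotients by p, and these range from 0 to (L - 1) /
    p. *)
Lemma card_congruent_lt (L p : nat) (D : {set 'I_L}) : 0 < p ->
  {in D &, forall i j : 'I_L, i = j %[mod p]} -> #|D| * p < L + p.
Proof.
move=> p_gt0 modD; case: L D modD => [|L] D modD.
  by rewrite (_ : #|D| = 0) ?mul0n //; apply: eq_card0 => -[].
suff : #|D| <= (L %/ p).+1.
  move=> le_D; apply: leq_ltn_trans (leq_mul le_D (leqnn p)) _.
  by rewrite mulSn addnC ltn_add2r ltnS leq_trunc_div.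
rewrite cardE -(size_map (fun i : 'I_L.+1 => i %/ p)) -[leqRHS](size_iota 0).
apply: uniq_leq_size => [|_ /mapP[i _ ->]]; last first.
  by rewrite mem_iota add0n ltnS leq_div2r // -ltnS.
rewrite map_inj_in_uniq ?enum_uniq // => i j; rewrite !mem_enum => iD jD eq_div.
by apply: val_inj; rewrite /= (divn_eq i p) eq_div (modD i j iD jD) -divn_eq.
Qed.

Lemma dvdn_abs_prog_diff (b c : int) (p i j : nat) : prime p -> ~~ (p %| `|c|) ->
  p %| `|(b + Posz i * c)%R| -> p %| `|(b + Posz j * c)%R| -> i = j %[mod p].
Proof.
move=> p_pr pNc pi pj.
have : (Posz p %| ((Posz i - Posz j) * c)%R)%Z.
  rewrite (_ : (_ * c = (b + Posz i * c) - (b + Posz j * c))%R); last by ring.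
  by rewrite rpredB // dvdzE.
rewrite dvdzE abszM Euclid_dvdM // (negPf pNc) orbF.
have -> : (p %| `|(Posz i - Posz j)%R|) = (Posz p %| (Posz i - Posz j)%R)%Z by rewrite dvdzE.
by rewrite -eqz_mod_dvd !modz_nat eqz_nat => /eqP.
Qed.

(** Z cuts off the small primes, so that two points have a product above Z^2 >= L; Y bounds from
    below the prime chosen off the longest line. N is the number of points and d the number of lines
    through that prime. In the first bound, the primes dividing c contribute at most |c| <= H and
    each of the N others at most X. *)
Lemma prog_degree (n X Y Z H L : nat) (b c : int) :
    X * X <= n -> Z <= Y -> L <= Z * Z -> 0 < H -> 0 < L ->
    (forall i, i < L -> (0 < b + Posz i * c <= Posz H)%R) ->
    (forall d, 0 < d <= n -> exists2 i, i < L & d %| `|(b + Posz i * c)%R|) ->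
    H * H < \prod_(Y.+1 <= p < X.+1 | prime p) p ->
  exists N d, [/\ \prod_(Z.+1 <= p < X.+1 | prime p) p <= H * X ^ N,
    N <= d ^ 2 + 1 & d * Y <= L + Y].
Proof.
move=> leXn leZY leLZ H_gt0 L_gt0 a_bnd a_div prodH.
set a := fun i : 'I_L => `|(b + Posz i * c)%R|.
have a_gt0 i : 0 < a i by have := a_bnd i (ltn_ord i); rewrite /a; lia.
have a_leH i : a i <= H by have := a_bnd i (ltn_ord i); rewrite /a; lia.
have prod_notdvd m : 0 < m <= H * H ->
    exists p, [/\ prime p, Y < p <= X & ~~ (p %| m)].
  case/andP=> m_gt0 le_mH; set r := index_iota Y.+1 X.+1.
  have [/allP all_m|] := boolP (all (fun p => prime p ==> (p %| m)) r).
    have dvd_m : \prod_(p <- r | prime p) p %| m.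
      apply: prod_primes_dvd => [|p /all_m]; first exact: iota_uniq.
      by move=> + p_pr; rewrite p_pr.
    by have := leq_trans prodH (dvdn_leq m_gt0 dvd_m); rewrite ltnNge le_mH.
  rewrite -has_predC => /hasP[p]; rewrite mem_index_iota /= negb_imply ltnS => pYX /andP[p_pr pNm].
  by exists p.
have leX p : p <= X -> p <= n.
  by move=> pX; apply: leq_trans leXn; nia.
(* In the generic case c is a difference of two members in (0, H]. If L = 1 or c = 0, the only
   member is b, and some prime up to n does not divide it, against the divisor property. *)
have c_bnd : 0 < `|c| <= H.
  have [/andP[L_gt1 c_neq0]|] := boolP ((1 < L) && (c != 0%R)).
    by have := a_bnd 0 L_gt0; have := a_bnd 1 L_gt1; lia.
  rewrite negb_and -leqNgt negbK => trivial_prog.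
  have [p [p_pr /andP[_ pX]]] : exists p, [/\ prime p, Y < p <= X & ~~ (p %| `|b|)].
    by apply: prod_notdvd; have := a_bnd 0 L_gt0; nia.
  have [|i iL] := a_div p; first by rewrite prime_gt0 // leX.
  rewrite (_ : (b + _)%R = b) => [->|] //.
  by case/orP: trivial_prog => [L1|/eqP->]; [rewrite (_ : i = 0) //; lia|lia].
pose P := [set p : 'I_X.+1 | [&& prime p, Z < p & ~~ (p %| `|c|)]].
pose S i := [set p in P | p %| a i].
have PE p : p \in P -> [/\ prime p, Z < p, p <= X & ~~ (p %| `|c|)].
  by rewrite inE => /and3P[p_pr Zp pNc]; split=> //; rewrite -ltnS ltn_ord.
have i1 : 'I_L := Ordinal L_gt0.
have [i0 _ S_max] : {i0 : 'I_L | true & forall i, #|S i| <= #|S i0|}.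
  by case: (@arg_maxnP _ i1 predT (fun i => #|S i|)) => // i0 _ S_max; exists i0 => // i; apply: S_max.
(* Avoiding c and the member [a i0] at once is what requires the prime product to exceed H^2 and not
   only H. *)
have [p0 [p0_pr /andP[Yp0 p0X]]] : exists p, [/\ prime p, Y < p <= X & ~~ (p %| `|c| * a i0)].
  apply: prod_notdvd; case/andP: c_bnd => c_gt0 c_leH.
  by rewrite muln_gt0 c_gt0 a_gt0 leq_mul.
rewrite Euclid_dvdM // negb_or => /andP[p0Nc p0Na].
pose p : 'I_X.+1 := Ordinal (p0X : p0 < X.+1).
have pP : p \in P by rewrite inE p0_pr p0Nc (leq_ltn_trans leZY).
have pNS : p \notin S i0 by rewrite inE negb_and p0Na orbT.
exists #|P|, #|[set i | p \in S i]|; split.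
- rewrite (bigID (fun q => q %| `|c|)) /= leq_mul //.
    apply: leq_trans (_ : `|c| <= H); last by case/andP: c_bnd.
    apply: dvdn_leq; first by case/andP: c_bnd.
    by apply: prod_primes_dvd => [|q _ /andP[-> ->]]; rewrite ?iota_uniq.
  rewrite big_geq_mkord (eq_bigl (fun q => q \in P)) => [|q]; last first.
    by rewrite inE -andbA [_ && (Z < q)]andbC.
  by rewrite -prod_nat_const; apply: leq_prod => q _; rewrite -ltnS.
- apply: linear_space_card_le pP pNS => //.
  + move=> q r /PE[q_pr Zq qX qNc] /PE[r_pr Zr rX rNc] qr.
    have qr_cop : coprime q r by rewrite prime_coprime // dvdn_prime2.
    have [|i iL] := a_div (q * r).
      by rewrite muln_gt0 !prime_gt0 //; apply: leq_trans leXn; apply: leq_mul.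
    rewrite Gauss_dvd // => /andP[q_a r_a].
    by exists (Ordinal iL); rewrite !inE ?q_pr ?Zq ?qNc ?r_pr ?Zr ?rNc.
  + move=> i j q r qr.
    rewrite inE => /andP[/PE[q_pr Zq _ qNc] qi]; rewrite inE => /andP[/PE[r_pr Zr _ rNc] ri].
    rewrite inE => /andP[_ qj]; rewrite inE => /andP[_ rj].
    have qr_cop : coprime q r by rewrite prime_coprime // dvdn_prime2.
    have /eqP eq_q := dvdn_abs_prog_diff q_pr qNc qi qj.
    have /eqP eq_r := dvdn_abs_prog_diff r_pr rNc ri rj.
    (* The indices agree modulo q r, and q r > Z^2 >= L, so they are equal. *)
    have : i == j %[mod q * r] by rewrite chinese_remainder // eq_q eq_r.
    have Lqr : L < q * r by apply: leq_ltn_trans leLZ _; rewrite ltn_mul.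
    by rewrite !modn_small ?(ltn_trans (ltn_ord _) Lqr) // => /eqP/val_inj.
  + by move=> i; apply/fintype.subsetP => q; rewrite inE => /andP[].
have : #|[set i | p \in S i]| * p < L + p.
  apply: card_congruent_lt => [|i j]; first exact: prime_gt0.
  rewrite !inE => /andP[_ pi] /andP[_ pj]; exact: (dvdn_abs_prog_diff p0_pr p0Nc pi pj).
(* One p is cancelled before p is replaced by Y: (d + 1) p < L + p gives d p < L, hence d Y <= L. *)
rewrite /=; case: #|_| => [|d]; first by rewrite mul0n.
rewrite mulSn addnC ltn_add2r mulSn addnC leq_add2r => /ltnW; apply: leq_trans.
by rewrite leq_mul2l ltnW ?orbT.
Qed.

Local Open Scope classical_set_scope.
Local Open Scope ring_scope.

(** * Real estimates and the bound for a single progression *)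

Section RealBounds.
Variable R : realType.

Lemma ln2_ge : 17 / 25 <= ln 2 :> R.
Proof.
(* Since (49/50)^34 * 2 >= 1, this yields ln 2 >= 34/50. *)
have ln_le : ln (49 / 50) <= - (1 / 50) :> R.
  by rewrite (_ : 49 / 50 = 1 + - (1 / 50)); [apply: le_ln1Dx|]; lra.
have q_gt0 : 0 < 49 / 50 :> R by lra.
have : 0 <= ln ((49 / 50) ^+ 34 * 2) :> R by apply: ln_ge0; lra.
by rewrite lnM ?posrE ?exprn_gt0 // lnXn // -[_ *+ 34]mulr_natr; lra.
Qed.

Lemma ler_ln_nat (m n : nat) : (0 < m <= n)%N -> ln m%:R <= ln n%:R :> R.
Proof.
case/andP=> m_gt0 le_mn.
by rewrite ler_ln ?posrE ?ltr0n ?ler_nat // (leq_trans m_gt0).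
Qed.

Lemma ln_natM (m n : nat) : (0 < m)%N -> (0 < n)%N ->
  ln (m * n)%:R = ln m%:R + ln n%:R :> R.
Proof. by move=> m0 n0; rewrite natrM lnM ?posrE ?ltr0n. Qed.

Lemma ln_natX (m n : nat) : (0 < m)%N -> ln (m ^ n)%:R = n%:R * ln m%:R :> R.
Proof. by move=> m0; rewrite natrX lnXn ?ltr0n // mulr_natl. Qed.

Lemma ln4 : ln 4%:R = 2 * ln 2 :> R.
Proof. exact: (ln_natX 2 (isT : 0 < 2)%N). Qed.

Lemma ln_primorial_le n : ln (primorial n)%:R <= n%:R * (2 * ln 2) :> R.
Proof.
by rewrite -ln4 -ln_natX // ler_ln_nat // primorial_gt0 primorial_ub.
Qed.

(** Writing a large number as t^4 bounds its logarithm by 4t and turns the error estimates into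
    polynomial inequalities in t. *)
Lemma ln_le_root4 (t : R) : 0 < t -> ln (t ^+ 4) <= 4 * t.
Proof. by move=> t0; rewrite lnXn // -[_ *+ 4]mulr_natl ler_pM2l // ltW // ln_sublinear. Qed.

Lemma ex_root4 (x : R) (a : R) : 0 < a -> a ^+ 4 <= x ->
  exists2 t, a <= t & t ^+ 4 = x.
Proof.
move=> a0 ax; have x0 : 0 <= x by apply: le_trans ax; rewrite exprn_ge0 // ltW.
exists (Num.sqrt (Num.sqrt x)); last first.
  by rewrite (exprM _ 2 2) !sqr_sqrtr ?sqrtr_ge0.
rewrite -(@ler_pXn2r _ 4) ?nnegrE ?sqrtr_ge0 //; last exact: ltW.
by rewrite [leRHS](exprM _ 2 2) !sqr_sqrtr ?sqrtr_ge0.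
Qed.

(** With n = t^4, the factors 2m + 1 and (2m)^r in [primorial_lb] cost at most 8t and 4t^3, since r
    <= t^2. Together with the loss of at most ln 2 from an odd n, this is below t^4 / 1000 once t >=
    10^4. *)
Lemma ln_primorial_ge (n : nat) : 10 ^+ 16 <= n%:R :> R ->
  n%:R * ln 2 - n%:R / 1000 <= ln (primorial n)%:R :> R.
Proof.
move=> n_ge; have [t t_ge def_n] : exists2 t, 10 ^+ 4 <= t & t ^+ 4 = n%:R :> R.
  by apply: ex_root4; rewrite ?exprn_gt0 // -exprM.
have n_gt1 : (1 < n)%N.
  by rewrite -(ltr_nat R); apply: lt_le_trans n_ge; lra.
set m := n./2; have m_gt0 : (0 < m)%N by lia.
have [r /andP[le_r lt_r]] := ex_sqrtn m.*2.
have := primorial_lb m_gt0 lt_r.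
have p_gt0 := primorial_gt0 m.*2.
move=> lb.
have : ln (4 ^ m)%:R <= ln (m.*2.+1 * (m.*2 ^ r * primorial m.*2))%:R :> R.
  by apply: ler_ln_nat; rewrite expn_gt0.
rewrite !ln_natM ?muln_gt0 ?expn_gt0 ?double_gt0 ?m_gt0 // !ln_natX ?double_gt0 // ln4.
have l1 : ln (m.*2.+1)%:R <= 2 * ln n%:R :> R.
  rewrite -(ln_natX 2) //; last lia.
  by apply: ler_ln_nat; rewrite -mulnn; nia.
have l2 : ln (m.*2)%:R <= ln n%:R :> R by apply: ler_ln_nat; lia.
have l3 : ln (primorial m.*2)%:R <= ln (primorial n)%:R :> R.
  apply: ler_ln_nat; rewrite p_gt0 (@primorial_cat m.*2 n); last lia.
  by rewrite leq_pmulr // prod_primes_gt0.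
have l4 : n%:R - 1 <= 2 * m%:R :> R.
  by rewrite -natrM -(natrB _ (ltnW n_gt1)) ler_nat; lia.
have ln_n : ln n%:R <= 4 * t by rewrite -def_n ln_le_root4 //; lra.
have l5 : r%:R <= t ^+ 2.
  rewrite -(@ler_pXn2r _ 2) ?nnegrE ?exprn_ge0 //; last by lra.
  by rewrite -exprM def_n -natrX ler_nat; lia.
have l6 : r%:R * ln (m.*2)%:R <= t ^+ 2 * (4 * t).
  apply: ler_pM => //; last exact: le_trans l2 ln_n.
  by apply: ln_ge0; rewrite ler1n double_gt0.
have ln2 := ln2_ge; have := ln_sublinear (ltr0n R 2 : 0 < 2).
have : (n%:R - 1) * ln 2 <= 2 * m%:R * ln 2 :> R by rewrite ler_wpM2r //; lra.
have t2 : 10 ^+ 4 * t <= t ^+ 2 by rewrite expr2; apply: ler_wpM2r => //; lra.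
have t3 : 10 ^+ 4 * t ^+ 2 <= t ^+ 3 by rewrite [t ^+ 3]exprS; apply: ler_wpM2r => //; nra.
have t4 : 10 ^+ 4 * t ^+ 3 <= t ^+ 4 by rewrite [t ^+ 4]exprS; apply: ler_wpM2r => //; nra.
rewrite -def_n in l1 ln_n *; nra.
Qed.

(** Both sides are nonnegative, so the inequality may be squared; this removes the fractional
    powers. *)
Lemma powR_ln_ratio_le (n y : R) : 1 < n -> 0 <= y ->
  8 / 27 * Num.sqrt n ^+ 3 <= y ^+ 2 * ln n ->
  Num.sqrt (8 / 27) * (n `^ (3 / 4) / Num.sqrt (ln n)) <= y.
Proof.
move=> n_gt1 y_ge0 le_y; have n_gt0 : 0 < n by apply: lt_trans n_gt1.
have ln_gt0 : 0 < ln n by apply: ln_gt0.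
rewrite -(@ler_pXn2r _ 2) ?nnegrE // ?mulr_ge0 ?invr_ge0 ?powR_ge0 ?sqrtr_ge0 //.
rewrite !exprMn exprVn !sqr_sqrtr; [|exact: ltW|lra].
rewrite mulrA ler_pdivrMr //; apply: le_trans le_y.
rewrite ler_pM2l; last by lra.
rewrite -(powR12_sqrt (ltW n_gt0)) -!powR_mulrn ?powR_ge0 // -!powRrM.
by rewrite (_ : 3 / 4 * 2%:R = 2^-1 * 3%:R) //; lra.
Qed.

(** Here x, l, q, y stand for X, ln X, Y, L. As d is large, y >= (d - 1) q costs only a factor
    199/200 against d q. The resulting constant 2 * (199/200)^2 * (33/50) * (489/1000)^2 is about
    0.312, against 8/27 < 0.297. *)
Lemma length_sqr_ge (x l d q y : R) :
  1000 <= x -> 0 < l -> 100 * 1000 * l <= x -> 0 <= d ->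
  33 / 50 * x <= d ^+ 2 * l -> 489 / 1000 * x <= q -> d * q <= y + q ->
  8 / 27 * (x + 1) ^+ 3 <= y ^+ 2 * (2 * l).
Proof.
move=> x_ge l_gt0 lx d_ge0 dl qx dq.
have x_gt0 : 0 < x by lra.
(* Otherwise d^2 l would be at most 40000 l <= 2x/5, less than 33x/50. *)
have d_ge : 200 <= d.
  rewrite leNgt; apply/negP => d_lt.
  have : d ^+ 2 <= 200 ^+ 2 by rewrite !expr2; apply: ler_pM => //; exact: ltW.
  move=> /(ler_wpM2r (ltW l_gt0)); lra.
have q_gt0 : 0 < q by lra.
have y_ge : 199 / 200 * d * q <= y.
  have : 0 <= (d / 200 - 1) * q by apply: mulr_ge0; [lra|exact: ltW].
  lra.
have {}y_ge : (199 / 200) ^+ 2 * (d ^+ 2 * q ^+ 2) <= y ^+ 2.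
  rewrite (_ : _ * (_ * _) = (199 / 200 * d * q) ^+ 2); last by ring.
  have ? : 0 <= 199 / 200 * d * q by apply: mulr_ge0; [apply: mulr_ge0|]; lra.
  by rewrite !expr2; apply: ler_pM.
have q2 : (489 / 1000) ^+ 2 * x ^+ 2 <= q ^+ 2.
  have ? : 0 <= 489 / 1000 * x by lra.
  rewrite -exprMn !expr2; exact: ler_pM.
have dlq := ler_pM _ _ dl q2.
have {dlq} : 33 / 50 * x * ((489 / 1000) ^+ 2 * x ^+ 2) <= d ^+ 2 * l * q ^+ 2.
  apply: dlq; first by lra.
  by apply: mulr_ge0; apply: exprn_ge0; lra.
have := ler_wpM2r (ltW l_gt0) y_ge.
have : 0 <= x ^+ 2 * (x - 1000) by apply: mulr_ge0; [apply: exprn_ge0|]; lra.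
have : 0 <= x * (x - 1000) by apply: mulr_ge0; lra.
lra.
Qed.

Lemma ln_le_linear (x : R) : 10 ^+ 16 <= x -> 100 * 1000 * ln x <= x.
Proof.
move=> x_ge; have [t t_ge <-] : exists2 t, 10 ^+ 4 <= t & t ^+ 4 = x.
  by apply: ex_root4; rewrite ?exprn_gt0 // -exprM.
have t_ge' : 1000 <= t by lra.
have t_gt0 : 0 < t by lra.
have := ln_le_root4 t_gt0.
have t2 : 1000 * t <= t ^+ 2 by rewrite expr2; apply: ler_wpM2r; lra.
have t3 : 1000 * t ^+ 2 <= t ^+ 3 by rewrite [t ^+ 3]exprS; apply: ler_wpM2r; lra.
have t4 : 1000 * t ^+ 3 <= t ^+ 4 by rewrite [t ^+ 4]exprS; apply: ler_wpM2r; lra.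
lra.
Qed.

Lemma ln_primorial_range (m n : nat) : (m <= n)%N ->
  ln (\prod_(m.+1 <= p < n.+1 | prime p) p)%:R =
  ln (primorial n)%:R - ln (primorial m)%:R :> R.
Proof.
move=> le_mn; rewrite (primorial_cat le_mn) ln_natM ?primorial_gt0.
- by rewrite addrAC subrr add0r.
- by [].
exact: prod_primes_gt0.
Qed.

Lemma divn_real_bounds (m d : nat) : (0 < d)%N ->
  m%:R - d%:R <= d%:R * (m %/ d)%:R :> R /\ d%:R * (m %/ d)%:R <= m%:R :> R.
Proof.
move=> d_gt0; rewrite -natrM lerBlDr -natrD !ler_nat mulnC; split; last exact: leq_trunc_div.
by rewrite addnC -mulSn ltnW // ltn_ceil.
Qed.

(** The two Chebyshev bounds differ by a factor 2, so the cutoff for Y must stay below x/2. At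
    49x/100 a margin of 2ex/100 remains, enough for x/1000 and 2h; the cutoff x/100 for Z costs only
    2ex/100 of the main term ex. *)
Lemma theta_margins (x e h tX tY tZ y z : R) :
  1000 * 1000 * 1000 <= x -> 17 / 25 <= e -> h <= (x + 1) / 2000 ->
  x * e - x / 1000 <= tX -> tY <= y * (2 * e) -> tZ <= z * (2 * e) ->
  100 * y <= 49 * x -> 100 * z <= x ->
  h + h < tX - tY /\ 331 / 500 * x + h <= tX - tZ.
Proof.
move=> x_ge e_ge h_le X_ge Y_le Z_le yx zx.
have e_gt0 : 0 < e by lra.
have := ler_wpM2r (ltW e_gt0) yx; have := ler_wpM2r (ltW e_gt0) zx.
have x_ge0 : 0 <= x by lra.
have := ler_wpM2l x_ge0 e_ge.
by move=> xe zxe yxe; split; lra.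
Qed.

(** The case L > Z^2: the length is then of order x^2, far above the required order x^(3/2). *)
Lemma large_length (x l y z : R) : 1000 * 1000 * 1000 <= x -> 1 <= l ->
  x - 100 <= 100 * z -> z * z <= y ->
  8 / 27 * (x + 1) ^+ 3 <= y ^+ 2 * (2 * l).
Proof.
move=> x_ge l_ge xz zy.
have z_ge0 : 0 <= z by lra.
pose w := x + 1.
have w_ge : 1000 * 1000 * 1000 <= w by rewrite /w; lra.
have zw : w <= 200 * z by rewrite /w; lra.
have w_ge0 : 0 <= w by lra.
have zw2 : w ^+ 2 <= 200 ^+ 2 * y.
  have : w * w <= (200 * z) * (200 * z) by apply: ler_pM.
  by lra.
have y2 : (w ^+ 2) ^+ 2 <= (200 ^+ 2) ^+ 2 * y ^+ 2.
  rewrite -exprMn; apply: lerXn2r; last exact: zw2; rewrite nnegrE; first exact: exprn_ge0.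
  by apply: le_trans zw2; exact: exprn_ge0.
have w4 : 1000 * 1000 * 1000 * w ^+ 3 <= (w ^+ 2) ^+ 2.
  rewrite -exprM [leRHS]exprS; apply: ler_wpM2r w_ge; exact: exprn_ge0.
have w3 : 0 <= w ^+ 3 by exact: exprn_ge0.
have yl : y ^+ 2 * 1 <= y ^+ 2 * l by apply: ler_wpM2l l_ge; exact: exprn_even_ge0.
rewrite -/w; clearbody w; lra.
Qed.

Lemma prog_length_ge (n L H : nat) (b c : int) :
    10 ^+ 16 + 1 <= Num.sqrt n%:R :> R -> (0 < L)%N -> (0 < H)%N ->
    (forall i, (i < L)%N -> 0 < b + i%:Z * c <= H%:Z) ->
    (forall d, (0 < d <= n)%N -> exists2 i, (i < L)%N & (d %| `|(b + i%:Z * c)%R|)%N) ->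
    ln H%:R <= Num.sqrt n%:R / 2000 :> R ->
  Num.sqrt (8 / 27) * (n%:R `^ (3 / 4) / Num.sqrt (ln n%:R)) <= L%:R :> R.
Proof.
move=> n_ge L_gt0 H_gt0 a_bnd a_div ln_H.
have [X /andP[le_Xn lt_nX]] := ex_sqrtn n.
pose x : R := X%:R; pose s : R := Num.sqrt n%:R.
have s_ge0 : 0 <= s by exact: sqrtr_ge0.
have le_sx : s <= x + 1.
  rewrite -(@ler_pXn2r _ 2) ?nnegrE //; last by rewrite natr1 ler0n.
  by rewrite sqr_sqrtr ?ler0n // natr1 -natrX ler_nat ltnW // -mulnn.
have x_ge16 : 10 ^+ 16 <= x by rewrite -(lerD2r 1); apply: le_trans le_sx.
have x_ge : 1000 * 1000 * 1000 <= x by lra.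
have l_lin : 100 * 1000 * ln x <= x := ln_le_linear x_ge16.
have theta_X := ln_primorial_ge x_ge16.
rewrite -/x in theta_X.
have {ln_H} h_le : ln H%:R <= (x + 1) / 2000 :> R.
  by rewrite -/s in ln_H; lra.
move: n_ge => _; clear x_ge16.
have X_gt0 : (0 < X)%N by rewrite -(ltr_nat R) -/x; lra.
have X_ge4 : (4 <= X)%N by rewrite -(ler_nat R) -/x; lra.
have l2 := ln2_ge.
have l_ge1 : 1 <= ln x.
  have : ln 4%:R <= ln x by rewrite ler_ln_nat.
  by rewrite ln4; lra.
have ln_n : 2 * ln x <= ln n%:R.
  by rewrite -(ln_natX 2) // ler_ln_nat // expn_gt0 X_gt0 -mulnn.
have n_gt1 : 1 < n%:R :> R.
  by rewrite ltr1n (leq_trans _ le_Xn) // (leq_trans _ (leq_mul X_ge4 X_ge4)).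
apply: powR_ln_ratio_le => //; rewrite -/s.
(* With sqrt n <= X + 1 and ln n >= 2 ln X, the goal is expressed through X alone. *)
suff : 8 / 27 * (x + 1) ^+ 3 <= L%:R ^+ 2 * (2 * ln x).
  have : s ^+ 3 <= (x + 1) ^+ 3 by apply: lerXn2r => //; rewrite nnegrE; lra.
  have : L%:R ^+ 2 * (2 * ln x) <= L%:R ^+ 2 * ln n%:R by rewrite ler_wpM2l ?exprn_ge0.
  lra.
pose Y := (49 * X %/ 100)%N; pose Z := (X %/ 100)%N.
have [YX YX'] := divn_real_bounds (49 * X) (isT : 0 < 100)%N.
have [ZX ZX'] := divn_real_bounds X (isT : 0 < 100)%N.
rewrite -/Y natrM -/x in YX YX'; rewrite -/Z -/x in ZX ZX'.
have leZY : (Z <= Y)%N by rewrite leq_div2r // leq_pmull.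
have leYX : (Y <= X)%N by rewrite -[leqRHS](@mulKn _ 100) // leq_div2r // leq_mul2r orbT.
have [leLZ|ltZL] := leqP L (Z * Z); last first.
  by apply: large_length x_ge l_ge1 ZX _; rewrite -natrM ler_nat ltnW.
have [ltY leZ] := theta_margins x_ge l2 h_le theta_X
  (ln_primorial_le Y) (ln_primorial_le Z) YX' ZX'.
rewrite -ln_primorial_range // in ltY.
rewrite -ln_primorial_range ?(leq_trans leZY leYX) // in leZ.
have big : (H * H < \prod_(Y.+1 <= p < X.+1 | prime p) p)%N.
  rewrite ltnNge; apply/negP => le_prod; move: ltY.
  rewrite -ln_natM // ltNge ler_ln_nat // le_prod andbT.
  exact: prod_primes_gt0.
have [N [d [prodN leN led]]] := prog_degree le_Xn leZY leLZ H_gt0 L_gt0 a_bnd a_div big.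
have lnN : ln (\prod_(Z.+1 <= p < X.+1 | prime p) p)%:R <= ln (H * X ^ N)%:R :> R.
  apply: ler_ln_nat; rewrite prodN andbT.
  exact: prod_primes_gt0.
rewrite ln_natM ?expn_gt0 ?X_gt0 // ln_natX // -/x in lnN.
have l_gt0 : 0 < ln x by apply: lt_le_trans l_ge1.
have leN' : N%:R * ln x <= (d%:R ^+ 2 + 1) * ln x.
  by apply: ler_wpM2r; [exact: ltW | rewrite -natrX natr1 ler_nat -addn1].
(* The summand ln H, already included in the margin [leZ], cancels. What remains is 331/500 * x <=
   (d^2 + 1) ln x; the final [lra] absorbs the extra ln x by lowering 331/500 to 33/50. *)
have {leZ lnN} := le_trans leZ lnN; rewrite addrC lerD2l => /le_trans/(_ leN') dl.
have led' : d%:R * Y%:R <= L%:R + Y%:R :> R by rewrite -natrM -natrD ler_nat.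
have d_ge0 : 0 <= d%:R :> R by exact: ler0n.
move: (d%:R) (Y%:R) (L%:R) YX dl led' d_ge0 => dR yR lR YX dl led' d_ge0.
by clear -x_ge l_gt0 l_lin d_ge0 led' YX dl; apply: (length_sqr_ge _ l_gt0 l_lin d_ge0 _ _ led'); lra.
Qed.

End RealBounds.

(** * Passage to the limit along the sequence *)

Theorem theorem1p1 (R : realType) (n : nat -> nat)
    (A : nat -> set int) (b c : nat -> int) (L : nat -> nat) (H : nat -> int)
    (n_gt0 : forall k, (0 < n k)%N)
    (n_oo : n k @[k --> \oo] --> \oo)
    (L_gt0 : forall k, (0 < L (n k))%N)
    (A_prog : forall k, A (n k) = arith_prog (b (n k)) (c (n k)) (L (n k)))
    (A_gt0 : forall k, A (n k) `<=` [set x : int | 0 < x])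
    (A_div : forall k, divisor_property (n k) (A (n k)))
    (H_max : forall k, is_max (A (n k)) (H (n k)))
    (H_littleo : (fun k => ln ((H (n k))%:~R : R)) =o_\oo
                 (fun k => Num.sqrt ((n k)%:R : R))) :
  (exists2 e : nat -> R, e k @[k --> \oo] --> (0 : R) &
     \forall k \near \oo,
       (Num.sqrt (8 / 27) - e k)
         * ((n k)%:R `^ (3 / 4) / Num.sqrt (ln (n k)%:R))
       <= (L (n k))%:R) /\
  (forall eps : R, 0 < eps ->
     \forall k \near \oo,
       (Num.sqrt (8 / 27) - eps)
         * ((n k)%:R `^ (3 / 4) / Num.sqrt (ln (n k)%:R))
       <= (L (n k))%:R).
Proof.
have key : \forall k \near \oo, Num.sqrt (8 / 27) *
    ((n k)%:R `^ (3 / 4) / Num.sqrt (ln (n k)%:R)) <= (L (n k))%:R :> R.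
  have ln_H : \forall k \near \oo,
      ln (H (n k))%:~R <= Num.sqrt (n k)%:R / 2000 :> R.
    (* The ratio 1/2000 is the allowance for ln H in [theta_margins]. *)
    move/eqoP: H_littleo => /(_ (1 / 2000)) near_H.
    have e_gt0 : 0 < 1 / 2000 :> R by lra.
    near=> k.
    have : `|ln (H (n k))%:~R| <= 1 / 2000 * `|Num.sqrt (n k)%:R| :> R.
      by near: k; exact: near_H.
    rewrite (ger0_norm (sqrtr_ge0 _)); have := ler_norm (ln (H (n k))%:~R : R); lra.
  (* Beyond K, sqrt n is at least 10^16 + 1, the threshold of [prog_length_ge]. *)
  have [K K_ge] : exists K, (10 ^+ 16 + 1) ^+ 2 <= K%:R :> R.
    by exists (Num.truncn ((10 ^+ 16 + 1) ^+ 2 : R)).+1; apply/ltW/truncnS_gt.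
  near=> k.
  have n_ge : (K <= n k)%N by near: k; exact: (n_oo _ (nbhs_infty_ge K)).
  have lnHk : ln (H (n k))%:~R <= Num.sqrt (n k)%:R / 2000 :> R by near: k.
  have [HA H_ub] := H_max k.
  have H_gt0 : 0 < H (n k) by exact: A_gt0 HA.
  have [h h_gt0 Hh] : exists2 h, (0 < h)%N & H (n k) = h%:Z.
    by case: (H (n k)) H_gt0 => // h h_gt0; exists h.
  rewrite Hh in lnHk H_ub.
  apply: (@prog_length_ge R _ _ h (b (n k)) (c (n k))) => //.
  - have x0 : 0 <= 10 ^+ 16 + 1 :> R by apply: addr_ge0 => //; exact: exprn_ge0.
    rewrite -(@ler_pXn2r _ 2) ?nnegrE ?sqrtr_ge0 // sqr_sqrtr ?ler0n //.
    by apply: le_trans K_ge _; rewrite ler_nat.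
  - move=> i iL; have Ai : A (n k) (b (n k) + i%:Z * c (n k)).
      by rewrite A_prog; exists i.
    by rewrite [X in X && _](A_gt0 k _ Ai) H_ub.
  - move=> d /(A_div k)[a]; rewrite A_prog => -[i iL <-]; rewrite dvdzE.
    by exists i.
have T_ge0 k : 0 <= (n k)%:R `^ (3 / 4) / Num.sqrt (ln (n k)%:R) :> R.
  by rewrite mulr_ge0 ?invr_ge0 ?powR_ge0 ?sqrtr_ge0.
split=> [|eps eps_gt0].
  exists (fun=> 0); first exact: cvg_cst.
  by apply: filterS key => k; rewrite subr0.
apply: filterS key => k; apply: le_trans; apply: ler_wpM2r => //.
by rewrite gerBl ltW.
Unshelve. all: by end_near.
Qed.
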